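(* For all $u,w\in\mathbb{Q}$ (with $u,w>1$) outside a proper algebraic curve in the $(u,w)$-plane, there are infinitely many hyperbolic triangles with all side lengths rational, two of whose sides have lengths $a=2\log u$ and $\log w$, and whose median to the side of length $a$ is rational.
   Context: Triangles are non-degenerate, bounded triangles in the hyperbolic plane (curvature $-1$). A length $\ell$ is rational if $e^\ell\in\mathbb{Q}$; the median to side $a$ is the geodesic segment from the opposite vertex to the midpoint of side $a$. *)

(* Defs.v *)
From Stdlib Require Import Reals QArith Qreals ZArith List.
Open Scope R_scope.

(** Hyperboloid model of the hyperbolic plane (curvature -1):
    points x = (x0,x1,x2) with x0 > 0 and x0^2 - x1^2 - x2^2 = 1. *)
Definition pt := (R * R * R)%type.

Definition c0 (x : pt) : R := fst (fst x).
Definition c1 (x : pt) : R := snd (fst x).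
Definition c2 (x : pt) : R := snd x.

Definition on_H (x : pt) : Prop :=
  0 < c0 x /\ c0 x ^ 2 - c1 x ^ 2 - c2 x ^ 2 = 1.

(** Minus the Minkowski form; equals cosh of the hyperbolic distance. *)
Definition mink (x y : pt) : R := c0 x * c0 y - c1 x * c1 y - c2 x * c2 y.

Definition arcosh (t : R) : R := ln (t + sqrt (t ^ 2 - 1)).

Definition hdist (x y : pt) : R := arcosh (mink x y).

(** Geodesics of the hyperboloid model are its intersections with planes
    through the origin, so three points are collinear iff the vectors are
    linearly dependent; non-degenerate = nonzero determinant. *)
Definition det3 (a b c : pt) : R :=
  c0 a * (c1 b * c2 c - c2 b * c1 c)
  - c1 a * (c0 b * c2 c - c2 b * c0 c)
  + c2 a * (c0 b * c1 c - c1 b * c0 c).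

Definition nondegenerate (a b c : pt) : Prop := det3 a b c <> 0.

Definition is_midpoint (M B C : pt) : Prop :=
  on_H M /\ hdist B M = hdist B C / 2 /\ hdist M C = hdist B C / 2.

Definition rational_length (l : R) : Prop := exists q : Q, exp l = Q2R q.

Definition good_third_side (u w : R) (c : R) : Prop :=
  exists A B C : pt,
    on_H A /\ on_H B /\ on_H C /\ nondegenerate A B C /\
    hdist B C = 2 * ln u /\ hdist C A = ln w /\ hdist A B = c /\
    rational_length (hdist B C) /\ rational_length (hdist C A) /\
    rational_length (hdist A B) /\
    exists M : pt, is_midpoint M B C /\ rational_length (hdist A M).

Definition poly2_eval (n : nat) (c : nat -> nat -> Z) (x y : R) : R :=
  sum_f_R0 (fun i => sum_f_R0 (fun j => IZR (c i j) * x ^ i * y ^ j) n) n.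

Definition poly2_nonzero (n : nat) (c : nat -> nat -> Z) : Prop :=
  exists i j, (i <= n)%nat /\ (j <= n)%nat /\ c i j <> 0%Z.

(* Main.v *)
Require Import Defs.
From Stdlib Require Import Reals QArith Qreals ZArith List Znumtheory Lra Lia Psatz Classical.
Open Scope R_scope.

(** Put U = u + 1/u, W = w + 1/w, v = e^c, x = e^m. The median formula
    cosh b + cosh c = 2 cosh (a/2) cosh m reads v + 1/v + W = U (x + 1/x), a curve of genus 1. With
    v = (1+p)/(1-p), x = (1+q)/(1-q) it becomes k0 + k1 p^2 + k2 q^2 + k3 p^2 q^2 = 0, on which the
    Jacobi curve C^2 = 1 - k0 k3 s^2, D^2 = 1 - k1 k2 s^2 acts by the addition formulas of sn.
    The degenerate triangle (v, x) = (w u^2, w u) is a rational point at the end of the real arc of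
    triangles, so it suffices to find rational points of the Jacobi curve arbitrarily close to its
    origin, with s <> 0: they move the degenerate triangle to rational non-degenerate ones.

    Such points are obtained among the multiples of one point P. If a prime l divides the numerator
    of u and not the denominator of w (replace w by 1/w if necessary), then the degenerate triangle
    is congruent modulo l to the point (0, 0) at infinity, and twice their difference is a
    point P in the kernel of reduction. There s(n P) = n s(P) modulo l^2 s(P), so P has infinite
    order. The real curve is compact, so two multiples of P are close to each other by the
    pigeonhole principle, and their difference is a multiple of P close to the origin. *)

(** * Rational numbers integral at a prime *)

(** The local ring of rationals with denominator prime to [l], placed inside the reals. Here [b] is
    nonzero because [l] divides 0. *)
Definition int_at (l : Z) (x : R) : Prop :=
  exists a b : Z, ~ (l | b)%Z /\ x * IZR b = IZR a.

Lemma not_divide_IZR_neq0 (l b : Z) : ~ (l | b)%Z -> IZR b <> 0.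
Proof.
  intros Hb H. apply Hb. apply eq_IZR_R0 in H. subst b. apply Z.divide_0_r.
Qed.

Lemma prime_not_divide_mul (l a b : Z) :
  prime l -> ~ (l | a)%Z -> ~ (l | b)%Z -> ~ (l | a * b)%Z.
Proof.
  intros Hl Ha Hb H. destruct (prime_mult l Hl a b H); tauto.
Qed.

Lemma int_at_IZR (l n : Z) : prime l -> int_at l (IZR n).
Proof.
  intros Hl. exists n, 1%Z. split; [| lra].
  intros H. apply Z.divide_1_r_nonneg in H; destruct Hl; lia.
Qed.

Lemma int_at_add (l : Z) (x y : R) : prime l -> int_at l x -> int_at l y -> int_at l (x + y).
Proof.
  intros Hl (a & b & Hb & E) (a' & b' & Hb' & E').
  exists (a * b' + a' * b)%Z, (b * b')%Z. split; [now apply prime_not_divide_mul |].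
  rewrite plus_IZR, !mult_IZR, <- E, <- E'. ring.
Qed.

Lemma int_at_mul (l : Z) (x y : R) : prime l -> int_at l x -> int_at l y -> int_at l (x * y).
Proof.
  intros Hl (a & b & Hb & E) (a' & b' & Hb' & E').
  exists (a * a')%Z, (b * b')%Z. split; [now apply prime_not_divide_mul |].
  rewrite !mult_IZR, <- E, <- E'. ring.
Qed.

Lemma int_at_opp (l : Z) (x : R) : int_at l x -> int_at l (- x).
Proof.
  intros (a & b & Hb & E). exists (- a)%Z, b. split; [assumption |].
  rewrite opp_IZR, <- E. ring.
Qed.

Lemma int_at_sub (l : Z) (x y : R) : prime l -> int_at l x -> int_at l y -> int_at l (x - y).
Proof.
  intros. apply int_at_add; auto using int_at_opp.
Qed.

Lemma int_at_pow (l : Z) (x : R) (n : nat) : prime l -> int_at l x -> int_at l (x ^ n).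
Proof.
  intros Hl Hx. induction n as [| n IH]; simpl.
  - now apply (int_at_IZR l 1).
  - now apply int_at_mul.
Qed.

Create HintDb int_at.
#[local] Hint Resolve int_at_IZR int_at_add int_at_mul int_at_opp int_at_sub int_at_pow : int_at.

(** Over the denominator [b] of [t] the numerator becomes [n * b + l * a], which is prime to [l].
    Nonvanishing is thus read off from residues modulo [l]. *)
Lemma int_at_unit (l n : Z) (t : R) : prime l -> ~ (l | n)%Z -> int_at l t ->
  IZR n + IZR l * t <> 0 /\ int_at l (/ (IZR n + IZR l * t)).
Proof.
  intros Hl Hn (a & b & Hb & E).
  assert (Hd : ~ (l | n * b + l * a)%Z).
  { intros H. apply (prime_not_divide_mul l n b Hl Hn Hb).
    replace (n * b)%Z with (n * b + l * a - l * a)%Z by ring.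
    apply Z.divide_sub_r; [assumption | apply Z.divide_factor_l]. }
  assert (Ed : (IZR n + IZR l * t) * IZR b = IZR (n * b + l * a)).
  { rewrite plus_IZR, !mult_IZR, <- E. ring. }
  assert (H0 : IZR n + IZR l * t <> 0).
  { intros H. rewrite H, Rmult_0_l in Ed.
    apply (not_divide_IZR_neq0 _ _ Hd). now symmetry. }
  split; [assumption |].
  exists b, (n * b + l * a)%Z. split; [assumption |].
  rewrite <- Ed. now field.
Qed.

(** The group of principal units of level 2 in the local ring. *)
Definition one_mod_sq (l : Z) (x : R) : Prop :=
  exists t, int_at l t /\ x = 1 + IZR l ^ 2 * t.

Lemma one_mod_sq_int_at (l : Z) (x : R) : prime l -> one_mod_sq l x -> int_at l x.
Proof.
  intros Hl (t & Ht & ->). auto 10 with int_at.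
Qed.

Lemma one_mod_sq_mul (l : Z) (x y : R) :
  prime l -> one_mod_sq l x -> one_mod_sq l y -> one_mod_sq l (x * y).
Proof.
  intros Hl (t & Ht & ->) (t' & Ht' & ->).
  exists (t + t' + IZR l ^ 2 * t * t'). split; [auto 10 with int_at | ring].
Qed.

Lemma one_mod_sq_add (l : Z) (x t : R) :
  prime l -> one_mod_sq l x -> int_at l t -> one_mod_sq l (x + IZR l ^ 2 * t).
Proof.
  intros Hl (t' & Ht' & ->) Ht.
  exists (t' + t). split; [auto with int_at | ring].
Qed.

Lemma one_mod_sq_unit (l : Z) (x : R) : prime l -> one_mod_sq l x ->
  x <> 0 /\ one_mod_sq l (/ x).
Proof.
  intros Hl (t & Ht & E).
  assert (H1 : ~ (l | 1)%Z).
  { intros H. apply Z.divide_1_r_nonneg in H; destruct Hl; lia. }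
  destruct (int_at_unit l 1 (IZR l * t) Hl H1) as [H0 Hi]; [auto with int_at |].
  replace (1 + IZR l * (IZR l * t)) with x in H0, Hi by (rewrite E; ring).
  split; [assumption |].
  exists (- (t * / x)). split; [auto with int_at |].
  rewrite E in *. field. assumption.
Qed.

(** * Jacobi curves *)

Definition sn (P : R * R * R) : R := fst (fst P).
Definition cn (P : R * R * R) : R := snd (fst P).
Definition dn (P : R * R * R) : R := snd P.

(** For [a = 1] and [b = k ^ 2] these are the classical relations between sn, cn and dn of modulus
    k. Two parameters leave room for rescaling [sn]. *)
Definition jacobi (a b : R) (P : R * R * R) : Prop :=
  cn P ^ 2 = 1 - a * sn P ^ 2 /\ dn P ^ 2 = 1 - b * sn P ^ 2.

Definition jden (a b : R) (P Q : R * R * R) : R := 1 - a * b * sn P ^ 2 * sn Q ^ 2.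

(** Jacobi's addition formulas; the neutral point is (0, 1, 1). *)
Definition jadd (a b : R) (P Q : R * R * R) : R * R * R :=
  ((sn P * cn Q * dn Q + sn Q * cn P * dn P) / jden a b P Q,
   (cn P * cn Q - a * sn P * sn Q * dn P * dn Q) / jden a b P Q,
   (dn P * dn Q - b * sn P * sn Q * cn P * cn Q) / jden a b P Q).

(* The first coordinate of [P - Q]. *)
Definition jdiff (a b : R) (P Q : R * R * R) : R :=
  (sn P * (cn Q * dn Q) - sn Q * (cn P * dn P)) / jden a b P Q.

Lemma jadd_jacobi (a b : R) (P Q : R * R * R) :
  jden a b P Q <> 0 -> jacobi a b P -> jacobi a b Q -> jacobi a b (jadd a b P Q).
Proof.
  destruct P as [[s1 c1] d1], Q as [[s2 c2] d2].
  unfold jacobi, jadd, jden, sn, cn, dn; cbn [fst snd].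
  intros HD [H1 H2] [H3 H4].
  set (D := 1 - a * b * s1 ^ 2 * s2 ^ 2) in *. split.
  - apply (Rmult_eq_reg_r (D ^ 2)); [| now apply pow_nonzero].
    transitivity ((c1 * c2 - a * s1 * s2 * d1 * d2) ^ 2); [field; assumption |].
    transitivity (D ^ 2 - a * (s1 * c2 * d2 + s2 * c1 * d1) ^ 2); [| field; assumption].
    unfold D. ring [H1 H2 H3 H4].
  - apply (Rmult_eq_reg_r (D ^ 2)); [| now apply pow_nonzero].
    transitivity ((d1 * d2 - b * s1 * s2 * c1 * c2) ^ 2); [field; assumption |].
    transitivity (D ^ 2 - b * (s1 * c2 * d2 + s2 * c1 * d1) ^ 2); [| field; assumption].
    unfold D. ring [H1 H2 H3 H4].
Qed.

(** On the quartic satisfied by [s] and [g = c * d], a sum has coordinates [N / D] and [G / D ^ 2].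
    The identity is (P + T) - (Q + T) = P - Q in the first coordinate, with denominators cleared. *)
Lemma quartic_diff_identity (f k s1 g1 s2 g2 s3 g3 : R) :
  g1 ^ 2 = 1 - f * s1 ^ 2 + k * s1 ^ 4 -> g2 ^ 2 = 1 - f * s2 ^ 2 + k * s2 ^ 4 ->
  g3 ^ 2 = 1 - f * s3 ^ 2 + k * s3 ^ 4 ->
  let D x y := 1 - k * x ^ 2 * y ^ 2 in
  let N x gx y gy := x * gy + y * gx in
  let G x gx y gy := gx * gy * (1 + k * x ^ 2 * y ^ 2)
    - x * y * (f * (1 + k * x ^ 2 * y ^ 2) - 2 * k * (x ^ 2 + y ^ 2)) in
  (N s1 g1 s3 g3 * D s1 s3 * G s2 g2 s3 g3 - N s2 g2 s3 g3 * D s2 s3 * G s1 g1 s3 g3) * D s1 s2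
  = (s1 * g2 - s2 * g1)
    * (D s1 s3 ^ 2 * D s2 s3 ^ 2 - k * N s1 g1 s3 g3 ^ 2 * N s2 g2 s3 g3 ^ 2).
Proof.
  intros H1 H2 H3 D N G; unfold D, N, G. ring [H1 H2 H3].
Qed.

(* The product of the last two coordinates of a sum, on the quartic g^2 = (1 - a s^2)(1 - b s^2). *)
Lemma jadd_quartic (a b : R) (P Q : R * R * R) :
  jden a b P Q <> 0 -> jacobi a b P -> jacobi a b Q ->
  cn (jadd a b P Q) * dn (jadd a b P Q) =
  (cn P * dn P * (cn Q * dn Q) * (1 + a * b * sn P ^ 2 * sn Q ^ 2)
   - sn P * sn Q * ((a + b) * (1 + a * b * sn P ^ 2 * sn Q ^ 2)
                    - 2 * (a * b) * (sn P ^ 2 + sn Q ^ 2))) / jden a b P Q ^ 2.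
Proof.
  destruct P as [[s1 c1] d1], Q as [[s2 c2] d2].
  unfold jacobi, jadd, jden, sn, cn, dn; cbn [fst snd].
  intros HD [H1 H2] [H3 H4].
  set (D := 1 - a * b * s1 ^ 2 * s2 ^ 2) in *.
  transitivity ((c1 * c2 - a * s1 * s2 * d1 * d2) * (d1 * d2 - b * s1 * s2 * c1 * c2) / D ^ 2);
    [field; assumption |].
  f_equal. ring [H1 H2 H3 H4].
Qed.

Lemma jacobi_quartic (a b : R) (P : R * R * R) : jacobi a b P ->
  (cn P * dn P) ^ 2 = 1 - (a + b) * sn P ^ 2 + (a * b) * sn P ^ 4.
Proof.
  intros [H1 H2]. rewrite Rpow_mult_distr, H1, H2. ring.
Qed.

(* The only instance of associativity that is needed. *)
Lemma jdiff_translation (a b : R) (P Q T : R * R * R) :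
  jacobi a b P -> jacobi a b Q -> jacobi a b T ->
  jden a b P Q <> 0 -> jden a b P T <> 0 -> jden a b Q T <> 0 ->
  jden a b (jadd a b P T) (jadd a b Q T) <> 0 ->
  jdiff a b (jadd a b P T) (jadd a b Q T) = jdiff a b P Q.
Proof.
  intros HP HQ HT DPQ DPT DQT DD.
  unfold jdiff. rewrite !jadd_quartic by assumption.
  pose proof (quartic_diff_identity (a + b) (a * b) (sn P) (cn P * dn P) (sn Q) (cn Q * dn Q)
    (sn T) (cn T * dn T) (jacobi_quartic _ _ _ HP) (jacobi_quartic _ _ _ HQ)
    (jacobi_quartic _ _ _ HT)) as E.
  cbv zeta in E.
  unfold jden in *. unfold jadd, jden in DD |- *. unfold sn, cn, dn in *.
  destruct P as [[s1 c1] d1], Q as [[s2 c2] d2], T as [[s3 c3] d3].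
  cbn [fst snd] in *.
  set (D13 := 1 - a * b * s1 ^ 2 * s3 ^ 2) in *.
  set (D23 := 1 - a * b * s2 ^ 2 * s3 ^ 2) in *.
  set (D12 := 1 - a * b * s1 ^ 2 * s2 ^ 2) in *.
  replace (s1 * c3 * d3 + s3 * c1 * d1) with (s1 * (c3 * d3) + s3 * (c1 * d1)) in * by ring.
  replace (s2 * c3 * d3 + s3 * c2 * d2) with (s2 * (c3 * d3) + s3 * (c2 * d2)) in * by ring.
  set (N13 := s1 * (c3 * d3) + s3 * (c1 * d1)) in *.
  set (N23 := s2 * (c3 * d3) + s3 * (c2 * d2)) in *.
  match type of E with (_ * _ * ?x - _ * _ * ?y) * _ = _ =>
    set (G23 := x) in *; set (G13 := y) in * end.
  set (M := D13 ^ 2 * D23 ^ 2 - a * b * N13 ^ 2 * N23 ^ 2) in *.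
  assert (EM : 1 - a * b * (N13 / D13) ^ 2 * (N23 / D23) ^ 2 = M / (D13 ^ 2 * D23 ^ 2))
    by (unfold M; field; now split).
  rewrite EM in *.
  assert (HM : M <> 0) by (intros H; apply DD; rewrite H; unfold Rdiv; ring).
  transitivity ((N13 * D13 * G23 - N23 * D23 * G13) / M); [field; now repeat split |].
  apply (Rmult_eq_reg_r (M * D12)); [| now apply Rmult_integral_contrapositive_currified].
  transitivity ((N13 * D13 * G23 - N23 * D23 * G13) * D12); [field; assumption |].
  rewrite E. field. assumption.
Qed.

Fixpoint jmul (a b : R) (P : R * R * R) (n : nat) : R * R * R :=
  match n with
  | O => (0, 1, 1)
  | S n => jadd a b (jmul a b P n) P
  end.

(** * Multiples of a point in the kernel of reduction *)

(** The kernel of reduction modulo [l]. The congruences for [cn] and [dn] are modulo [l ^ 2] because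
    these coordinates depend on [sn ^ 2]. *)
Definition near_origin (l : Z) (P : R * R * R) : Prop :=
  (exists t, int_at l t /\ sn P = IZR l * t) /\ one_mod_sq l (cn P) /\ one_mod_sq l (dn P).

Lemma near_origin_jden (l : Z) (a b : R) (P Q : R * R * R) :
  prime l -> int_at l a -> int_at l b -> near_origin l P -> near_origin l Q ->
  one_mod_sq l (jden a b P Q).
Proof.
  intros Hl Ha Hb [(t & Ht & E) _] [(t' & Ht' & E') _].
  unfold jden. rewrite E, E'.
  exists (- (a * b * t ^ 2 * IZR l ^ 2 * t' ^ 2)). split; [auto 10 with int_at | ring].
Qed.

(** Each product [sn P * sn Q] contributes a factor [l ^ 2], so modulo [l ^ 2] the last two
    coordinates and the denominator stay equal to 1. *)
Lemma near_origin_jadd (l : Z) (a b : R) (P Q : R * R * R) :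
  prime l -> int_at l a -> int_at l b -> near_origin l P -> near_origin l Q ->
  near_origin l (jadd a b P Q).
Proof.
  intros Hl Ha Hb HP HQ.
  destruct (one_mod_sq_unit l _ Hl (near_origin_jden l a b P Q Hl Ha Hb HP HQ)) as [_ HD].
  destruct HP as [(t & Ht & E) [Hc Hd]], HQ as [(t' & Ht' & E') [Hc' Hd']].
  pose proof (one_mod_sq_int_at l _ Hl Hc). pose proof (one_mod_sq_int_at l _ Hl Hd).
  pose proof (one_mod_sq_int_at l _ Hl Hc'). pose proof (one_mod_sq_int_at l _ Hl Hd').
  pose proof (one_mod_sq_int_at l _ Hl HD).
  unfold jadd, near_origin, Rdiv.
  set (D := / jden a b P Q) in *. clearbody D.
  unfold sn, cn, dn in *; cbn [fst snd]. rewrite E, E'. split; [| split].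
  - eexists; split; [| rewrite !Rmult_assoc, <- Rmult_plus_distr_l, Rmult_assoc; reflexivity].
    auto 10 with int_at.
  - apply one_mod_sq_mul; [assumption | | assumption].
    match goal with |- one_mod_sq l (?x - a * (_ * t) * (_ * t') * ?p * ?q) =>
      replace (x - a * (IZR l * t) * (IZR l * t') * p * q)
        with (x + IZR l ^ 2 * - (a * t * t' * p * q)) by ring end.
    apply one_mod_sq_add; auto 10 using one_mod_sq_mul with int_at.
  - apply one_mod_sq_mul; [assumption | | assumption].
    match goal with |- one_mod_sq l (?x - b * (_ * t) * (_ * t') * ?p * ?q) =>
      replace (x - b * (IZR l * t) * (IZR l * t') * p * q)
        with (x + IZR l ^ 2 * - (b * t * t' * p * q)) by ring end.
    apply one_mod_sq_add; auto 10 using one_mod_sq_mul with int_at.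
Qed.

Lemma near_origin_zero (l : Z) : prime l -> near_origin l (0, 1, 1).
Proof.
  intros Hl. unfold near_origin, sn, cn, dn; cbn [fst snd].
  assert (one_mod_sq l 1) by (exists 0; split; [auto with int_at | ring]).
  split; [| now split]. exists 0. split; [auto with int_at | ring].
Qed.

Lemma jmul_near_origin (l : Z) (a b : R) (P : R * R * R) (n : nat) :
  prime l -> int_at l a -> int_at l b -> near_origin l P -> near_origin l (jmul a b P n).
Proof.
  intros Hl Ha Hb HP. induction n as [| n IH]; simpl.
  - now apply near_origin_zero.
  - now apply near_origin_jadd.
Qed.

(** An arithmetic reason for the addition formulas to be defined on all multiples of [P], whatever
    the signs of [a] and [b]. *)
Lemma near_origin_jden_neq0 (l : Z) (a b : R) (P Q : R * R * R) :
  prime l -> int_at l a -> int_at l b -> near_origin l P -> near_origin l Q ->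
  jden a b P Q <> 0.
Proof.
  intros Hl Ha Hb HP HQ.
  apply (one_mod_sq_unit l _ Hl (near_origin_jden l a b P Q Hl Ha Hb HP HQ)).
Qed.

Lemma jmul_jacobi (l : Z) (a b : R) (P : R * R * R) (n : nat) :
  prime l -> int_at l a -> int_at l b -> near_origin l P -> jacobi a b P ->
  jacobi a b (jmul a b P n).
Proof.
  intros Hl Ha Hb HP HJ. induction n as [| n IH]; simpl.
  - unfold jacobi, sn, cn, dn; cbn [fst snd]. split; ring.
  - apply jadd_jacobi; auto.
    apply (near_origin_jden_neq0 l); auto using jmul_near_origin.
Qed.

(** The difference of the multiples n + k and n is the multiple k: each induction step translates
    both points by [P]. *)
Lemma jdiff_jmul (l : Z) (a b : R) (P : R * R * R) (k n : nat) :
  prime l -> int_at l a -> int_at l b -> near_origin l P -> jacobi a b P ->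
  jdiff a b (jmul a b P (n + k)) (jmul a b P n) = sn (jmul a b P k).
Proof.
  intros Hl Ha Hb HP HJ. induction n as [| n IH]; simpl.
    unfold jdiff, jden, sn, cn, dn; cbn [fst snd]. field.
  - rewrite jdiff_translation; [assumption | ..];
      eauto using jmul_jacobi;
      apply (near_origin_jden_neq0 l); auto using jmul_near_origin, near_origin_jadd.
Qed.

(** By induction on [j], solving the difference formula of [jdiff_jmul] for the next first
    coordinate. All other quantities in that formula are 1 modulo [l ^ 2], so each step adds 1 to
    the multiplier. *)
Lemma sn_jmul_mul (l : Z) (a b : R) (P : R * R * R) (m j : nat) :
  prime l -> int_at l a -> int_at l b -> near_origin l P -> jacobi a b P ->
  exists t, int_at l t /\
    sn (jmul a b P (j * m)) = sn (jmul a b P m) * (IZR (Z.of_nat j) + IZR l ^ 2 * t).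
Proof.
  intros Hl Ha Hb HP HJ. induction j as [| j IH].
  - exists 0. split; [auto with int_at |]. simpl. unfold sn at 1; cbn [fst snd]. ring.
  - destruct IH as (t & Ht & E).
    pose proof (jdiff_jmul l a b P m (j * m) Hl Ha Hb HP HJ) as Ed.
    replace (S j * m)%nat with (j * m + m)%nat by lia.
    pose proof (jmul_near_origin l a b P (j * m) Hl Ha Hb HP) as HB.
    pose proof (jmul_near_origin l a b P (j * m + m) Hl Ha Hb HP) as HA.
    pose proof (near_origin_jden l a b _ _ Hl Ha Hb HA HB) as HD.
    destruct HA as [_ [HAc HAd]], HB as [_ [HBc HBd]].
    pose proof (one_mod_sq_mul l _ _ Hl HAc HAd) as (x & Hx & Ex).
    pose proof (one_mod_sq_mul l _ _ Hl HBc HBd) as HgB.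
    destruct (one_mod_sq_unit l _ Hl HgB) as [HB0 (y & Hy & Ey)].
    destruct (one_mod_sq_unit l _ Hl HD) as [HD0 _].
    destruct HD as (z & Hz & Ez).
    unfold jdiff in Ed. rewrite E in Ed.
    set (sM := sn (jmul a b P m)) in *.
    set (gB := cn (jmul a b P (j * m)) * dn (jmul a b P (j * m))) in *.
    set (gA := cn (jmul a b P (j * m + m)) * dn (jmul a b P (j * m + m))) in *.
    set (D := jden a b _ _) in *.
    set (sA := sn (jmul a b P (j * m + m))) in *.
    clearbody sM gB gA D sA.
    set (w := IZR l ^ 2) in *. set (J := IZR (Z.of_nat j)) in *.
    assert (HJi : int_at l J) by (unfold J; auto with int_at).
    assert (Hw : int_at l w) by (unfold w; auto with int_at).
    assert (EJ : IZR (Z.of_nat (S j)) = J + 1)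
      by (unfold J; rewrite Nat2Z.inj_succ, succ_IZR; reflexivity).
    rewrite EJ. clearbody w J.
    (* The coefficient of [w] left after subtracting [J + 1] from [(D + (J + w * t) * gA) / gB],
       where [D = 1 + w * z], [gA = 1 + w * x] and [/ gB = 1 + w * y]. *)
    exists (z + t + (J + w * t) * x + (1 + w * z + (J + w * t) * (1 + w * x)) * y).
    split; [auto 15 with int_at |].
    assert (EA : sA = sM * (D + (J + w * t) * gA) * / gB).
    { apply (Rmult_eq_reg_r (gB * / D)); [| apply Rmult_integral_contrapositive_currified;
        [assumption | now apply Rinv_neq_0_compat]].
      transitivity ((sA * gB - sM * (J + w * t) * gA) / D + sM * (J + w * t) * gA / D);
        [field; assumption |].
      rewrite Ed. field. now split. }
    rewrite EA, Ey, Ez, Ex. ring.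
Qed.

(** Strong induction on [k]. If [l] does not divide [k], the multiplier of [sn P] is a unit at [l];
    otherwise [k = l * m], and the multiplier of the coordinate at [m] is [l] times a unit. *)
Lemma sn_jmul_neq0 (l : Z) (a b : R) (P : R * R * R) (k : nat) :
  prime l -> int_at l a -> int_at l b -> near_origin l P -> jacobi a b P ->
  sn P <> 0 -> (0 < k)%nat -> sn (jmul a b P k) <> 0.
Proof.
  intros Hl Ha Hb HP HJ H0.
  assert (E1 : sn (jmul a b P 1) = sn P).
  { unfold jmul, jadd, jden, sn, cn, dn; cbn [fst snd]. field. }
  assert (Hl2 : (2 <= l)%Z) by (destruct Hl; lia).
  induction k as [k IH] using (well_founded_induction Nat.lt_wf_0). intros Hk.
  destruct (classic (l | Z.of_nat k)%Z) as [[q Hq] | Hdiv].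
  - set (m := Z.to_nat q). set (j := Z.to_nat l).
    assert (Hq0 : (0 < q)%Z) by nia.
    assert (Ek : k = (j * m)%nat) by (unfold j, m; nia).
    assert (Hm : (0 < m < k)%nat) by (unfold m; nia).
    destruct (sn_jmul_mul l a b P m j Hl Ha Hb HP HJ) as (t & Ht & E).
    rewrite Ek, E. unfold j. rewrite Z2Nat.id by lia.
    apply Rmult_integral_contrapositive_currified; [apply IH; lia |].
    replace (IZR l + IZR l ^ 2 * t) with (IZR l * (1 + IZR l * t)) by ring.
    apply Rmult_integral_contrapositive_currified.
    + apply not_0_IZR. lia.
    + apply (int_at_unit l 1); auto.
      intros H. apply Z.divide_1_r_nonneg in H; lia.
  - destruct (sn_jmul_mul l a b P 1 k Hl Ha Hb HP HJ) as (t & Ht & E).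
    rewrite Nat.mul_1_r, E1 in E. rewrite E.
    apply Rmult_integral_contrapositive_currified; [assumption |].
    replace (IZR (Z.of_nat k) + IZR l ^ 2 * t)
      with (IZR (Z.of_nat k) + IZR l * (IZR l * t)) by ring.
    apply (int_at_unit l (Z.of_nat k)); auto with int_at.
Qed.

(** * Approximating the origin *)

Definition unbounded (S : nat -> Prop) : Prop := forall N, exists n, (N <= n)%nat /\ S n.

Lemma unbounded_split (S A : nat -> Prop) :
  unbounded S -> unbounded (fun n => S n /\ A n) \/ unbounded (fun n => S n /\ ~ A n).
Proof.
  intros HS. destruct (classic (unbounded (fun n => S n /\ A n))) as [H | H]; [now left | right].
  apply not_all_ex_not in H as [N HN]. intros M.
  destruct (HS (N + M)%nat) as (n & Hn & HSn). exists n. split; [lia |]. split; [assumption |].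
  intros HA. apply HN. exists n. split; [lia | now split].
Qed.

(** Pigeonhole principle: cut the range into intervals of length [e]; one of them receives
    infinitely many indices. Keeping an infinite set allows a second application to another
    coordinate. *)
Lemma unbounded_cluster (S : nat -> Prop) (f : nat -> R) (K e : R) :
  0 < e -> unbounded S -> (forall n, S n -> Rabs (f n) <= K) ->
  exists S' : nat -> Prop, unbounded S' /\ (forall n, S' n -> S n) /\
    forall m n, S' m -> S' n -> Rabs (f m - f n) < e.
Proof.
  intros He HS HK.
  assert (main : forall (N : nat) (x : R) (T : nat -> Prop), unbounded T ->
    (forall n, T n -> x <= f n < x + INR N * e) ->
    exists S' : nat -> Prop, unbounded S' /\ (forall n, S' n -> T n) /\
      forall m n, S' m -> S' n -> Rabs (f m - f n) < e).
  { induction N as [| N IH]; intros x T HT Hf.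
    - destruct (HT 0%nat) as (n & _ & Hn). specialize (Hf n Hn). simpl in Hf. lra.
    - destruct (unbounded_split T (fun n => f n < x + e) HT) as [H | H].
      + exists (fun n => T n /\ f n < x + e). split; [assumption | split; [tauto |]].
        intros m n [Hm Hm'] [Hn Hn']. pose proof (Hf m Hm). pose proof (Hf n Hn).
        apply Rabs_def1; lra.
      + destruct (IH (x + e) _ H) as (S' & H1 & H2 & H3).
        * intros n [Hn Hn']. specialize (Hf n Hn). rewrite S_INR in Hf. lra.
        * exists S'. split; [assumption | split; [| assumption]].
          intros n Hn. now apply H2. }
  destruct (INR_unbounded (2 * K / e + 1)) as [N HN].
  apply (main N (- K) S HS).
  intros n Hn. specialize (HK n Hn).
  pose proof (Rle_abs (f n)). pose proof (Rle_abs (- f n)) as Hneg. rewrite Rabs_Ropp in Hneg.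
  assert (2 * K + e < INR N * e); [| lra].
  replace (2 * K + e) with ((2 * K / e + 1) * e) by (field; lra).
  now apply Rmult_lt_compat_r.
Qed.

Lemma jacobi_sn_bound (a b : R) (P : R * R * R) :
  jacobi a b P -> a * sn P ^ 2 <= 1.
Proof.
  intros [H _]. pose proof (pow2_ge_0 (cn P)). lra.
Qed.

(** The denominator is [1 - b / a * (X * Y)] with [X] and [Y] in [0, 1]. When [b < a] the bound is
    positive. *)
Lemma jden_lower_bound (a b : R) (P Q : R * R * R) :
  0 < a -> jacobi a b P -> jacobi a b Q -> Rmin 1 (1 - b / a) <= jden a b P Q.
Proof.
  intros Ha HP HQ.
  apply jacobi_sn_bound in HP, HQ.
  assert (E : jden a b P Q = 1 - b / a * ((a * sn P ^ 2) * (a * sn Q ^ 2)))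
    by (unfold jden; field; lra).
  rewrite E.
  assert (0 <= a * sn P ^ 2) by (pose proof (pow2_ge_0 (sn P)); nra).
  assert (0 <= a * sn Q ^ 2) by (pose proof (pow2_ge_0 (sn Q)); nra).
  set (X := a * sn P ^ 2) in *. set (Y := a * sn Q ^ 2) in *. clearbody X Y.
  assert (0 <= X * Y <= 1) by nra.
  destruct (Rle_dec (b / a) 0).
  - apply (Rle_trans _ 1); [apply Rmin_l | nra].
  - apply (Rle_trans _ (1 - b / a)); [apply Rmin_r | nra].
Qed.

(** Compactness of the real curve for positive [a], stated for the two quantities that occur in the
    numerator of [jdiff]. *)
Lemma jacobi_coordinates_bound (a b : R) (P : R * R * R) :
  0 < a -> jacobi a b P ->
  Rabs (sn P) <= 1 + / a + Rabs b / a /\ Rabs (cn P * dn P) <= 1 + / a + Rabs b / a.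
Proof.
  intros Ha HP. pose proof (jacobi_sn_bound _ _ _ HP) as Hs.
  pose proof (Rinv_0_lt_compat a Ha) as Hi. pose proof (Rabs_pos b) as Hb0.
  assert (Hs' : sn P ^ 2 <= / a).
  { apply (Rmult_le_reg_l a); [assumption |]. rewrite Rinv_r; lra. }
  assert (Hb : - b * sn P ^ 2 <= Rabs b / a).
  { pose proof (Rle_abs (- b)) as H. rewrite Rabs_Ropp in H.
    pose proof (pow2_ge_0 (sn P)). unfold Rdiv. nra. }
  assert (HK : 0 <= Rabs b / a) by (unfold Rdiv; nra).
  set (K := Rabs b / a) in *. clearbody K.
  assert (Hg : (cn P * dn P) ^ 2 <= 1 + K).
  { destruct HP as [Hc Hd]. rewrite Rpow_mult_distr.
    assert (0 <= cn P ^ 2 <= 1)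
      by (pose proof (pow2_ge_0 (cn P)); pose proof (pow2_ge_0 (sn P)); nra).
    assert (0 <= dn P ^ 2 <= 1 + K) by (pose proof (pow2_ge_0 (dn P)); lra).
    nra. }
  split; apply Rabs_le; split; nra.
Qed.

Lemma jacobi_small_point (l : Z) (a b : R) (P : R * R * R) (eps : R) :
  prime l -> int_at l a -> int_at l b -> 0 < a -> b < a ->
  near_origin l P -> jacobi a b P -> sn P <> 0 -> 0 < eps ->
  exists Q, near_origin l Q /\ jacobi a b Q /\ sn Q <> 0 /\ Rabs (sn Q) < eps.
Proof.
  intros Hl Ha Hb Ha0 Hba HP HJ H0 Heps.
  pose (Q := jmul a b P).
  assert (HQ : forall n, jacobi a b (Q n)) by (intros n; now apply (jmul_jacobi l)).
  pose (K := 1 + / a + Rabs b / a).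
  assert (HK : forall n, Rabs (sn (Q n)) <= K /\ Rabs (cn (Q n) * dn (Q n)) <= K)
    by (intros n; now apply jacobi_coordinates_bound).
  assert (HK0 : 0 < K).
  { unfold K. pose proof (Rinv_0_lt_compat a Ha0). pose proof (Rabs_pos b).
    unfold Rdiv. nra. }
  pose (dl := Rmin 1 (1 - b / a)).
  assert (Hdl : 0 < dl).
  { unfold dl. apply Rmin_glb_lt; [lra |].
    assert (b / a < 1); [| lra]. apply (Rmult_lt_reg_r a); [assumption |].
    unfold Rdiv. rewrite Rmult_assoc, Rinv_l; lra. }
  (* The numerator of the difference will be at most [2 * K * e], below [eps * dl], and its
     denominator at least [dl]. *)
  pose (e := eps * dl / (4 * K)).
  assert (He : 0 < e).
  { unfold e. apply Rdiv_lt_0_compat; nra. }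
  destruct (unbounded_cluster (fun _ => True) (fun n => sn (Q n)) K e He) as (S1 & HS1 & _ & Hs).
  { intros N. exists N. split; [lia | trivial]. }
  { intros n _. apply HK. }
  destruct (unbounded_cluster S1 (fun n => cn (Q n) * dn (Q n)) K e He HS1)
    as (S2 & HS2 & HS21 & Hg).
  { intros n _. apply HK. }
  destruct (HS2 0%nat) as (n & _ & Hn).
  (* Starting from [n + 1] makes [k = m - n] positive, hence [sn (Q k)] nonzero. *)
  destruct (HS2 (n + 1)%nat) as (m & Hmn & Hm).
  specialize (Hs m n (HS21 m Hm) (HS21 n Hn)). specialize (Hg m n Hm Hn). simpl in Hs, Hg.
  pose (k := (m - n)%nat).
  exists (Q k). split; [now apply jmul_near_origin |]. split; [apply HQ |].
  split; [apply (sn_jmul_neq0 l); auto; unfold k; lia |].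
  pose proof (jdiff_jmul l a b P k n Hl Ha Hb HP HJ) as E.
  replace (n + k)%nat with m in E by (unfold k; lia).
  unfold Q. rewrite <- E. unfold jdiff. fold (Q m) (Q n).
  pose proof (jden_lower_bound a b (Q m) (Q n) Ha0 (HQ m) (HQ n)) as HD. fold dl in HD.
  unfold Rdiv. rewrite Rabs_mult, (Rabs_right (/ _))
    by (apply Rle_ge, Rlt_le, Rinv_0_lt_compat; lra).
  apply (Rmult_lt_reg_r (jden a b (Q m) (Q n))); [lra |].
  rewrite Rmult_assoc, Rinv_l, Rmult_1_r by lra.
  apply (Rlt_le_trans _ (eps * dl)); [| nra].
  destruct (HK m) as [HKs HKg].
  replace (sn (Q m) * (cn (Q n) * dn (Q n)) - sn (Q n) * (cn (Q m) * dn (Q m)))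
    with (sn (Q m) * - (cn (Q m) * dn (Q m) - cn (Q n) * dn (Q n))
          + (sn (Q m) - sn (Q n)) * (cn (Q m) * dn (Q m))) by ring.
  eapply Rle_lt_trans; [apply Rabs_triang |].
  rewrite !(Rabs_mult (sn (Q m))), Rabs_Ropp, (Rabs_mult (sn (Q m) - sn (Q n))).
  assert (Ee : eps * dl = 4 * K * e) by (unfold e; field; lra).
  rewrite Ee.
  pose proof (Rabs_pos (sn (Q m))).
  pose proof (Rabs_pos (cn (Q m) * dn (Q m))).
  pose proof (Rabs_pos (cn (Q m) * dn (Q m) - cn (Q n) * dn (Q n))).
  pose proof (Rabs_pos (sn (Q m) - sn (Q n))).
  nra.
Qed.

Lemma continuity_pt_lt (f : R -> R) (x K : R) :
  continuity_pt f x -> f x < K ->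
  exists dl, 0 < dl /\ forall y, Rabs (y - x) < dl -> f y < K.
Proof.
  intros Hf HK. destruct (Hf (K - f x)) as (dl & Hdl & H); [lra |].
  exists dl. split; [assumption |]. intros y Hy.
  destruct (Req_dec x y) as [<- | Hxy]; [assumption |].
  assert (Hd : Rabs (f y - f x) < K - f x).
  { apply H. split; [| exact Hy]. split; [exact I | assumption]. }
  pose proof (Rle_abs (f y - f x)). lra.
Qed.

(** Besides (0, 1, 1), the real points with [sn = 0] include those with signs changed; positivity of
    [cn] and [dn] singles out the neighbourhood of the origin. *)
Definition small_points (l : Z) (a b : R) : Prop :=
  forall eps, 0 < eps -> exists P, near_origin l P /\ jacobi a b P /\
    0 < Rabs (sn P) < eps /\ 0 < cn P /\ 0 < dn P.

Lemma jadd_self (a b : R) (P : R * R * R) : jacobi a b P ->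
  sn (jadd a b P P) = 2 * sn P * cn P * dn P / jden a b P P /\
  cn (jadd a b P P) = (1 - 2 * a * sn P ^ 2 + a * b * sn P ^ 4) / jden a b P P /\
  dn (jadd a b P P) = (1 - 2 * b * sn P ^ 2 + a * b * sn P ^ 4) / jden a b P P.
Proof.
  destruct P as [[s c] d]. unfold jacobi, jadd, sn, cn, dn; cbn [fst snd].
  intros [Hc Hd]. repeat split; f_equal; [ring | ring [Hc Hd] | ring [Hc Hd]].
Qed.

(* Doubling makes the coordinates [cn] and [dn] rational functions of [sn ^ 2], equal to 1 at 0. *)
Lemma small_points_of_seed (l : Z) (a b : R) (P : R * R * R) :
  prime l -> int_at l a -> int_at l b -> 0 < a -> b < a ->
  near_origin l P -> jacobi a b P -> sn P <> 0 -> small_points l a b.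
Proof.
  intros Hl Ha Hb Ha0 Hba HP HJ H0 eps Heps.
  (* The first function is the square of [sn] of the double of a point with [sn = s]. The other
     three keep the denominator and the numerators of [cn] and [dn] of the double positive. *)
  destruct (continuity_pt_lt
    (fun s => 4 * s ^ 2 * (1 - a * s ^ 2) * (1 - b * s ^ 2) / (1 - a * b * s ^ 4) ^ 2)
    0 (eps ^ 2)) as (d1 & Hd1 & H1); [reg; rewrite !pow_ne_zero by lia; nra | simpl; nra |].
  destruct (continuity_pt_lt (fun s => a * b * s ^ 4) 0 1) as (d2 & Hd2 & H2);
    [reg | simpl; nra |].
  destruct (continuity_pt_lt (fun s => 2 * a * s ^ 2 - a * b * s ^ 4) 0 1) as (d3 & Hd3 & H3);
    [reg | simpl; nra |].
  destruct (continuity_pt_lt (fun s => 2 * b * s ^ 2 - a * b * s ^ 4) 0 1) as (d4 & Hd4 & H4);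
    [reg | simpl; nra |].
  destruct (jacobi_small_point l a b P (Rmin (Rmin d1 d2) (Rmin d3 d4)))
    as (Q & HQ & HJQ & HQ0 & HQs); auto.
  { repeat apply Rmin_glb_lt; assumption. }
  pose proof (Rmin_l (Rmin d1 d2) (Rmin d3 d4)). pose proof (Rmin_r (Rmin d1 d2) (Rmin d3 d4)).
  pose proof (Rmin_l d1 d2). pose proof (Rmin_r d1 d2).
  pose proof (Rmin_l d3 d4). pose proof (Rmin_r d3 d4).
  specialize (H1 (sn Q)); specialize (H2 (sn Q)); specialize (H3 (sn Q)); specialize (H4 (sn Q)).
  rewrite Rminus_0_r in H1, H2, H3, H4.
  specialize (H1 ltac:(lra)); specialize (H2 ltac:(lra)).
  specialize (H3 ltac:(lra)); specialize (H4 ltac:(lra)).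
  exists (jadd a b Q Q).
  pose proof (near_origin_jden_neq0 l a b Q Q Hl Ha Hb HQ HQ) as HD.
  pose proof HJQ as [Hc Hd].
  assert (ED : jden a b Q Q = 1 - a * b * sn Q ^ 4) by (unfold jden; ring).
  assert (Hcn : cn Q <> 0)
    by (destruct HQ as (_ & HQc & _); now apply (one_mod_sq_unit l)).
  assert (Hdn : dn Q <> 0)
    by (destruct HQ as (_ & _ & HQd); now apply (one_mod_sq_unit l)).
  split; [now apply near_origin_jadd |]. split; [now apply jadd_jacobi |].
  destruct (jadd_self a b Q HJQ) as (Es & Ec & Ed).
  rewrite ED in HD, Es, Ec, Ed.
  assert (HDpos : 0 < 1 - a * b * sn Q ^ 4) by lra.
  rewrite Es, Ec, Ed. repeat split.
  - apply Rabs_pos_lt. unfold Rdiv.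
    repeat apply Rmult_integral_contrapositive_currified; auto; try lra.
    now apply Rinv_neq_0_compat.
  - rewrite <- (Rabs_right eps) by lra. apply Rsqr_lt_abs_0. unfold Rsqr.
    assert (E : 2 * sn Q * cn Q * dn Q / (1 - a * b * sn Q ^ 4)
                * (2 * sn Q * cn Q * dn Q / (1 - a * b * sn Q ^ 4))
                = 4 * sn Q ^ 2 * (1 - a * sn Q ^ 2) * (1 - b * sn Q ^ 2)
                  / (1 - a * b * sn Q ^ 4) ^ 2)
      by (rewrite <- Hc, <- Hd; field; lra).
    rewrite E. lra.
  - apply Rdiv_lt_0_compat; lra.
  - apply Rdiv_lt_0_compat; lra.
Qed.

Lemma jacobi_coordinates (a b s c d : R) :
  c ^ 2 = 1 - a * s ^ 2 /\ d ^ 2 = 1 - b * s ^ 2 -> jacobi a b (s, c, d).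
Proof. exact (fun H => H). Qed.

(** The two shapes serve the exchange of coordinates used for negative [a], once in each
    direction. *)
Lemma near_origin_div (l : Z) (s x y : R) : prime l ->
  (exists t, int_at l t /\ s = IZR l * t) -> one_mod_sq l x -> one_mod_sq l y ->
  forall P, P = (s / x, / x, y / x) \/ P = (s / x, y / x, / x) -> near_origin l P.
Proof.
  intros Hl (t & Ht & E) Hx Hy P HP.
  destruct (one_mod_sq_unit l x Hl Hx) as [_ Hx'].
  pose proof (one_mod_sq_int_at l _ Hl Hx').
  assert (Hs : exists t', int_at l t' /\ s / x = IZR l * t').
  { exists (t * / x). split; [auto with int_at | rewrite E; unfold Rdiv; ring]. }
  destruct HP as [-> | ->]; (split; [exact Hs |]); split; unfold Rdiv; cbn;
    auto using one_mod_sq_mul.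
Qed.

(* When [a < 0] the coordinate [sn] is unbounded on the real curve; dividing by [dn] exchanges
   the roles of the coordinates and gives a curve with positive first parameter. *)
Lemma small_points_swap (l : Z) (a b : R) (P : R * R * R) :
  prime l -> int_at l a -> int_at l b -> a < 0 -> b < a ->
  near_origin l P -> jacobi a b P -> sn P <> 0 -> small_points l a b.
Proof.
  intros Hl Ha Hb Ha0 Hba [HPs [HPc HPd]] [Hc Hd] H0 eps Heps.
  destruct (one_mod_sq_unit l _ Hl HPd) as [Hd0 _].
  (* Dividing the two equations by [dn ^ 2] gives the parameters [- b] and [a - b]; here [- b] is
     positive and exceeds [a - b] because [b < a < 0]. *)
  assert (HS : small_points l (- b) (a - b)).
  { apply (small_points_of_seed l _ _ (sn P / dn P, / dn P, cn P / dn P));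
      auto with int_at; try lra.
    - apply (near_origin_div l (sn P) (dn P) (cn P)); auto.
    - apply jacobi_coordinates. split.
      + assert (E : dn P ^ 2 + b * sn P ^ 2 = 1) by lra.
        transitivity ((dn P ^ 2 + b * sn P ^ 2) / dn P ^ 2); [rewrite E |]; field; assumption.
      + transitivity ((cn P ^ 2) / dn P ^ 2); [field; assumption |].
        transitivity ((dn P ^ 2 - (a - b) * sn P ^ 2) / dn P ^ 2); [| field; assumption].
        rewrite Hc, Hd. f_equal. ring.
    - change (sn P / dn P <> 0). unfold Rdiv.
      apply Rmult_integral_contrapositive_currified; auto using Rinv_neq_0_compat. }
  (* The square of [sn / cn] on the exchanged curve, which is the first coordinate after going
     back. *)
  destruct (continuity_pt_lt (fun s => s ^ 2 / (1 + b * s ^ 2)) 0 (eps ^ 2))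
    as (d1 & Hd1 & H1); [reg; simpl; lra | simpl; nra |].
  destruct (HS d1 Hd1) as (Q & [HQs [HQc HQd]] & [Jc Jd] & HQ & Hcn & Hdn).
  exists (sn Q / cn Q, dn Q / cn Q, / cn Q).
  split; [apply (near_origin_div l (sn Q) (cn Q) (dn Q)); auto |].
  split; [| change (0 < Rabs (sn Q / cn Q) < eps /\ 0 < dn Q / cn Q /\ 0 < / cn Q); repeat split].
  - apply jacobi_coordinates. split.
    + transitivity (dn Q ^ 2 / cn Q ^ 2); [field; lra |].
      transitivity ((cn Q ^ 2 - a * sn Q ^ 2) / cn Q ^ 2); [| field; lra].
      rewrite Jc, Jd. f_equal. ring.
    + assert (E : cn Q ^ 2 - b * sn Q ^ 2 = 1) by lra.
      transitivity ((cn Q ^ 2 - b * sn Q ^ 2) / cn Q ^ 2); [rewrite E |]; field; lra.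
  - apply Rabs_pos_lt. unfold Rdiv.
    apply Rmult_integral_contrapositive_currified;
      [intros E; rewrite E, Rabs_R0 in HQ; lra | apply Rinv_neq_0_compat; lra].
  - rewrite <- (Rabs_right eps) by lra. apply Rsqr_lt_abs_0. unfold Rsqr.
    specialize (H1 (sn Q)). rewrite Rminus_0_r in H1. specialize (H1 ltac:(lra)).
    replace (1 + b * sn Q ^ 2) with (cn Q ^ 2) in H1 by (rewrite Jc; ring).
    replace (sn Q / cn Q * (sn Q / cn Q)) with (sn Q ^ 2 / cn Q ^ 2) by (field; lra).
    lra.
  - now apply Rdiv_lt_0_compat.
  - now apply Rinv_0_lt_compat.
Qed.

(** * A point in the kernel of reduction *)

(* The double of a point [(s, g)] of the quartic g^2 = (1 - a s^2)(1 - b s^2). *)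
Lemma seed_jacobi (a b s g : R) :
  g ^ 2 = (1 - a * s ^ 2) * (1 - b * s ^ 2) -> 1 - a * b * s ^ 4 <> 0 ->
  jacobi a b (2 * s * g / (1 - a * b * s ^ 4),
    (1 - 2 * a * s ^ 2 + a * b * s ^ 4) / (1 - a * b * s ^ 4),
    (1 - 2 * b * s ^ 2 + a * b * s ^ 4) / (1 - a * b * s ^ 4)).
Proof.
  intros Hg HD. apply jacobi_coordinates.
  assert (E : forall e f, e ^ 2 = (1 - a * b * s ^ 4) ^ 2 - 4 * f * s ^ 2 * g ^ 2 ->
    (e / (1 - a * b * s ^ 4)) ^ 2 = 1 - f * (2 * s * g / (1 - a * b * s ^ 4)) ^ 2).
  { set (D := 1 - a * b * s ^ 4) in *. intros e f H.
    transitivity (e ^ 2 / D ^ 2); [field; assumption |]. rewrite H. field. assumption. }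
  split; apply E; rewrite Hg; ring.
Qed.

(** Only [2 * s] must be divisible by [l], since the point used is the double of [(s, g)]; this
    leaves room for the prime 2. *)
Lemma seed_small_points (l : Z) (a b s g x y z : R) :
  prime l -> int_at l a -> int_at l b -> a <> 0 -> b < a ->
  g ^ 2 = (1 - a * s ^ 2) * (1 - b * s ^ 2) -> s <> 0 -> g <> 0 ->
  int_at l g -> int_at l x -> int_at l y -> int_at l z ->
  a * s ^ 2 = IZR l ^ 2 * x -> b * s ^ 2 = IZR l ^ 2 * y -> 2 * s = IZR l * z ->
  small_points l a b.
Proof.
  intros Hl Ha Hb Ha0 Hba Hg Hs Hg0 Ig Ix Iy Iz Ex Ey Ez.
  assert (E4 : a * b * s ^ 4 = IZR l ^ 2 * (IZR l ^ 2 * x * y))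
    by (transitivity ((a * s ^ 2) * (b * s ^ 2)); [ring | rewrite Ex, Ey; ring]).
  assert (HD : one_mod_sq l (1 - a * b * s ^ 4)).
  { rewrite E4. exists (- (IZR l ^ 2 * x * y)). split; [auto 20 with int_at | ring]. }
  destruct (one_mod_sq_unit l _ Hl HD) as [HD0 HDi].
  pose proof (one_mod_sq_int_at l _ Hl HDi) as IDi.
  pose proof (seed_jacobi a b s g Hg HD0) as HJ.
  match type of HJ with jacobi _ _ ?p => set (P := p) in * end.
  assert (HP : near_origin l P).
  { split; [| split].
    - exists (z * g * / (1 - a * b * s ^ 4)). split; [auto 20 with int_at |].
      unfold P, sn; cbn [fst snd]. rewrite Ez. unfold Rdiv. ring.
    - change (one_mod_sq l ((1 - 2 * a * s ^ 2 + a * b * s ^ 4) * / (1 - a * b * s ^ 4))).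
      apply one_mod_sq_mul; auto.
      exists (- 2 * x + IZR l ^ 2 * x * y). split; [auto 20 with int_at |].
      rewrite E4. replace (2 * a * s ^ 2) with (2 * (a * s ^ 2)) by ring. rewrite Ex. ring.
    - change (one_mod_sq l ((1 - 2 * b * s ^ 2 + a * b * s ^ 4) * / (1 - a * b * s ^ 4))).
      apply one_mod_sq_mul; auto.
      exists (- 2 * y + IZR l ^ 2 * x * y). split; [auto 20 with int_at |].
      rewrite E4. replace (2 * b * s ^ 2) with (2 * (b * s ^ 2)) by ring. rewrite Ey. ring. }
  assert (HP0 : sn P <> 0).
  { change (2 * s * g / (1 - a * b * s ^ 4) <> 0). unfold Rdiv.
    repeat apply Rmult_integral_contrapositive_currified; auto using Rinv_neq_0_compat; lra. }
  destruct (Rlt_or_le 0 a).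
  - now apply (small_points_of_seed l a b P).
  - apply (small_points_swap l a b P); auto; lra.
Qed.

(* The seed is the double of the translation carrying (v,x) = (0,0) to the degenerate triangle
   (v,x) = (w u^2, w u); at a prime dividing the numerator of [u] these two points are congruent. *)
Lemma curve_small_points (l : Z) (u t w : R) :
  prime l -> int_at l t -> int_at l w -> u = IZR l * t -> 0 < u -> 0 < w ->
  let a := u ^ 2 * (w ^ 2 + 1) ^ 2 - 4 * w ^ 2 * (u ^ 2 - u + 1) ^ 2 in
  let b := u ^ 2 * (w ^ 2 + 1) ^ 2 - 4 * w ^ 2 * (u ^ 2 + u + 1) ^ 2 in
  a <> 0 -> small_points l a b.
Proof.
  intros Hl It Iw Eu Hu Hw a b Ha0.
  pose (D := 2 * w ^ 2 * u ^ 4 + u ^ 2 * w ^ 2 - u ^ 2 - 2).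
  pose (g := 4 * (u ^ 2 + 1) * (u ^ 6 * w ^ 4 - 1) / D ^ 2).
  assert (Iu : int_at l u) by (rewrite Eu; auto 20 with int_at).
  assert (Ia : int_at l a) by (unfold a; auto 20 with int_at).
  assert (Ib : int_at l b) by (unfold b; auto 20 with int_at).
  assert (Hba : b < a).
  { assert (E : a - b = 16 * u * w ^ 2 * (u ^ 2 + 1)) by (unfold a, b; ring).
    assert (0 < u * w ^ 2 * (u ^ 2 + 1)) by (repeat apply Rmult_lt_0_compat; nra). lra. }
  assert (Hl1 : ~ (l | -1)%Z).
  { intros H. apply Z.divide_opp_r, Z.divide_1_r_nonneg in H; destruct Hl; lia. }
  (* It is -1 modulo [l]. This makes [g], and hence [sn] of the seed, nonzero. *)
  assert (Hnum : u ^ 6 * w ^ 4 - 1 <> 0).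
  { replace (u ^ 6 * w ^ 4 - 1) with (-1 + IZR l * (t * u ^ 5 * w ^ 4)) by (rewrite Eu; ring).
    apply (int_at_unit l (-1)); auto 20 with int_at. }
  assert (Hpos : u ^ 2 + 1 <> 0) by nra.
  assert (Hg : D <> 0 -> g ^ 2 = (1 - a * (u / D) ^ 2) * (1 - b * (u / D) ^ 2)).
  { intros HD. unfold g.
    transitivity ((D ^ 2 - a * u ^ 2) * (D ^ 2 - b * u ^ 2) / D ^ 4); [| field; assumption].
    transitivity ((4 * (u ^ 2 + 1) * (u ^ 6 * w ^ 4 - 1)) ^ 2 / D ^ 4); [field; assumption |].
    f_equal. unfold D, a, b. ring. }
  assert (Hg0 : D <> 0 -> g <> 0).
  { intros HD. unfold g, Rdiv.
    repeat apply Rmult_integral_contrapositive_currified; auto; try lra.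
    now apply Rinv_neq_0_compat, pow_nonzero. }
  assert (Hs0 : D <> 0 -> u / D <> 0).
  { intros HD. unfold Rdiv.
    apply Rmult_integral_contrapositive_currified; [lra | now apply Rinv_neq_0_compat]. }
  (* Since [D] is -2 modulo [l], it is a unit only for odd [l]. For [l = 2] one has [D = 2 * M] with
     [M] a unit, and the factors 2 and 4 cancel. *)
  destruct (classic (l | 2)%Z) as [H2 | H2].
  - assert (l = 2)%Z as ->.
    { apply Z.divide_pos_le in H2; [| lia]. destruct Hl; lia. }
    pose (r := 8 * w ^ 2 * t ^ 4 + t ^ 2 * w ^ 2 - t ^ 2).
    destruct (int_at_unit 2 (-1) r Hl Hl1) as [HM IM]; [unfold r; auto 20 with int_at |].
    set (M := -1 + 2 * r) in *.
    assert (ED : D = 2 * M) by (unfold D, M, r; rewrite Eu; ring).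
    assert (HD : D <> 0) by (rewrite ED; lra).
    assert (Es : u / D = t * / M) by (rewrite ED, Eu; field; assumption).
    specialize (Hs0 HD). specialize (Hg0 HD). specialize (Hg HD).
    assert (Ig : int_at 2 g).
    { replace g with ((u ^ 2 + 1) * (u ^ 6 * w ^ 4 - 1) * (/ M) ^ 2)
        by (unfold g; rewrite ED; field; assumption).
      auto 20 with int_at. }
    rewrite Es in *.
    apply (seed_small_points 2 a b (t * / M) g
      ((t ^ 2 * (w ^ 2 + 1) ^ 2 - w ^ 2 * (u ^ 2 - u + 1) ^ 2) * (t * / M) ^ 2)
      ((t ^ 2 * (w ^ 2 + 1) ^ 2 - w ^ 2 * (u ^ 2 + u + 1) ^ 2) * (t * / M) ^ 2) (t * / M));
      auto 20 with int_at.
    + rewrite <- Rmult_assoc. f_equal. unfold a. rewrite Eu. ring.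
    + rewrite <- Rmult_assoc. f_equal. unfold b. rewrite Eu. ring.
  - pose (r := 2 * w ^ 2 * u ^ 3 * t + t * u * w ^ 2 - t * u).
    destruct (int_at_unit l (-2) r Hl) as [HD ID];
      [intros [k Hk]; apply H2; exists (- k)%Z; lia | unfold r; auto 20 with int_at |].
    replace (-2 + IZR l * r) with D in HD, ID by (unfold D, r; rewrite Eu; ring).
    specialize (Hs0 HD). specialize (Hg0 HD). specialize (Hg HD).
    assert (Ig : int_at l g).
    { replace g with (4 * (u ^ 2 + 1) * (u ^ 6 * w ^ 4 - 1) * (/ D) ^ 2)
        by (unfold g; field; assumption).
      auto 20 with int_at. }
    apply (seed_small_points l a b (u / D) g
      (a * (t * / D) ^ 2) (b * (t * / D) ^ 2) (2 * (t * / D))); auto 20 with int_at;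
      rewrite Eu; field; assumption.
Qed.

(** * Rational points of the Jacobi curve near the origin *)

Definition rational (x : R) : Prop := exists q : Q, x = Q2R q.

Lemma rational_IZR (n : Z) : rational (IZR n).
Proof.
  exists (inject_Z n). unfold Q2R, inject_Z; simpl. field.
Qed.

Lemma rational_add (x y : R) : rational x -> rational y -> rational (x + y).
Proof.
  intros [p ->] [q ->]. exists (p + q)%Q. now rewrite Q2R_plus.
Qed.

Lemma rational_mul (x y : R) : rational x -> rational y -> rational (x * y).
Proof.
  intros [p ->] [q ->]. exists (p * q)%Q. now rewrite Q2R_mult.
Qed.

Lemma rational_opp (x : R) : rational x -> rational (- x).
Proof.
  intros [p ->]. exists (- p)%Q. now rewrite Q2R_opp.
Qed.

Lemma rational_sub (x y : R) : rational x -> rational y -> rational (x - y).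
Proof.
  intros. apply rational_add; auto using rational_opp.
Qed.

Lemma rational_inv (x : R) : rational x -> rational (/ x).
Proof.
  intros [p ->]. destruct (Qeq_dec p 0) as [E | E].
  - exists 0%Q. rewrite (Qeq_eqR _ _ E), RMicromega.Q2R_0. apply Rinv_0.
  - exists (/ p)%Q. now rewrite Q2R_inv.
Qed.

Lemma rational_pow (x : R) (n : nat) : rational x -> rational (x ^ n).
Proof.
  intros Hx. induction n as [| n IH]; simpl; [apply (rational_IZR 1) | now apply rational_mul].
Qed.

Ltac prove_rational :=
  unfold Rdiv;
  repeat first [assumption | apply rational_IZR | apply rational_sub | apply rational_add
    | apply rational_mul | apply rational_opp | apply rational_inv | apply rational_pow].

Lemma int_at_rational (l : Z) (x : R) : int_at l x -> rational x.
Proof.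
  intros (a & b & Hb & E). apply not_divide_IZR_neq0 in Hb.
  replace x with (IZR a * / IZR b) by (rewrite <- E; now field).
  prove_rational.
Qed.

Lemma exists_prime_divisor (m : Z) : (1 < m)%Z -> exists l, prime l /\ (l | m)%Z.
Proof.
  intros Hm. assert (H0 : (0 <= m)%Z) by lia. revert m H0 Hm.
  apply (Z_lt_induction (fun m => (1 < m)%Z -> exists l, prime l /\ (l | m)%Z)). intros m IH Hm.
  destruct (prime_dec m) as [Hp | Hp].
  - exists m. split; [assumption | apply Z.divide_refl].
  - destruct (not_prime_divide m Hm Hp) as (n & Hn & Hd).
    destruct (IH n) as (l & Hl & Hln); try lia.
    exists l. split; [assumption |]. now apply Z.divide_trans with n.
Qed.

Lemma Q_lowest_terms (q : Q) : exists m n : Z,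
  (0 < n)%Z /\ (forall l, prime l -> (l | m)%Z -> ~ (l | n)%Z) /\ Q2R q = IZR m / IZR n.
Proof.
  destruct q as [a b].
  pose (g := Z.gcd a (Zpos b)).
  assert (Hg : g <> 0%Z) by (intros H; apply Z.gcd_eq_0_r in H; lia).
  assert (Hg0 : (0 < g)%Z) by (pose proof (Z.gcd_nonneg a (Zpos b)); unfold g in *; lia).
  destruct (Z.gcd_divide_l a (Zpos b)) as [m Em]. destruct (Z.gcd_divide_r a (Zpos b)) as [n En].
  fold g in Em, En.
  exists m, n. split; [nia |]. split.
  - intros l Hl [i Hi] [j Hj].
    assert (Hd : (l * g | g)%Z).
    { apply Z.gcd_greatest; [exists i | exists j]; rewrite ?Em, ?En, ?Hi, ?Hj; ring. }
    apply Z.divide_pos_le in Hd; [| assumption]. destruct Hl. nia.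
  - unfold Q2R; simpl. rewrite Em, En, !mult_IZR.
    assert (IZR n <> 0) by (apply not_0_IZR; nia).
    assert (IZR g <> 0) by (now apply not_0_IZR).
    field. now split.
Qed.

(** Multiplying [sn] by [x * w1] transports the points of [curve_small_points], whose parameters are
    [a] and [b] times [(x * w1) ^ 2]. *)
Lemma rational_jacobi_small (u w : Q) (eps : R) :
  1 < Q2R u -> 1 < Q2R w -> 0 < eps ->
  let U := Q2R u + / Q2R u in
  let W := Q2R w + / Q2R w in
  let a := W ^ 2 - 4 * (U - 1) ^ 2 in
  let b := W ^ 2 - 4 * (U + 1) ^ 2 in
  a <> 0 ->
  exists s c d, rational s /\ rational c /\ rational d /\ 0 < s < eps /\
    0 < c /\ 0 < d /\ c ^ 2 = 1 - a * s ^ 2 /\ d ^ 2 = 1 - b * s ^ 2.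
Proof.
  intros Hu Hw Heps U W a b Ha.
  destruct (Q_lowest_terms u) as (m & n & Hn & Hmn & Eu).
  destruct (Q_lowest_terms w) as (r & k & Hk & Hrk & Ew).
  assert (Hn' : 0 < IZR n) by now apply IZR_lt.
  assert (Hk' : 0 < IZR k) by now apply IZR_lt.
  assert (Hm : (1 < m)%Z).
  { assert (n < m)%Z; [| lia]. apply lt_IZR.
    rewrite Eu in Hu. apply (Rmult_lt_compat_r (IZR n)) in Hu; [| assumption].
    unfold Rdiv in Hu. rewrite Rmult_assoc, Rinv_l in Hu; lra. }
  destruct (exists_prime_divisor m Hm) as (l & Hl & [m' Hm']).
  assert (Hln : ~ (l | n)%Z) by (apply Hmn; [assumption | now exists m']).
  set (x := Q2R u) in *. set (y := Q2R w) in *. clearbody x y.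
  (* In lowest terms [l] cannot divide both parts of [w], and [W] is unchanged when [w] is
     inverted. *)
  assert (Iw : exists w1, int_at l w1 /\ 0 < w1 /\ (w1 = y \/ w1 = / y)).
  { destruct (classic (l | k)%Z) as [Hlk | Hlk].
    - assert (Hlr : ~ (l | r)%Z) by (intros H; now apply (Hrk l Hl H)).
      exists (/ y). split; [| split; [apply Rinv_0_lt_compat; lra | now right]].
      exists k, r. split; [assumption |]. rewrite Ew.
      field. split; [lra | now apply not_divide_IZR_neq0 in Hlr].
    - exists y. split; [| split; [lra | now left]].
      exists r, k. split; [assumption |]. rewrite Ew. field. lra. }
  destruct Iw as (w1 & Iw & Hw1 & Ew1).
  assert (EW : W = w1 + / w1).
  { unfold W. destruct Ew1 as [-> | ->]; [reflexivity |]. rewrite Rinv_inv. ring. }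
  assert (Ea : x ^ 2 * (w1 ^ 2 + 1) ^ 2 - 4 * w1 ^ 2 * (x ^ 2 - x + 1) ^ 2 = a * (x * w1) ^ 2)
    by (unfold a, U; rewrite EW; field; lra).
  assert (Eb : x ^ 2 * (w1 ^ 2 + 1) ^ 2 - 4 * w1 ^ 2 * (x ^ 2 + x + 1) ^ 2 = b * (x * w1) ^ 2)
    by (unfold b, U; rewrite EW; field; lra).
  assert (Hxw : 0 < x * w1) by nra.
  destruct (curve_small_points l x (IZR m' / IZR n) w1) with (eps := eps / (x * w1))
    as (P & [(t & Ht & EP) [HPc HPd]] & HJ & HP & Hc & Hd); auto.
  { exists m', n. split; [assumption |]. field. lra. }
  { rewrite Eu, Hm', mult_IZR. field. lra. }
  { lra. }
  { rewrite Ea. apply Rmult_integral_contrapositive_currified; [assumption |].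
    apply pow_nonzero. lra. }
  { now apply Rdiv_lt_0_compat. }
  rewrite Ea, Eb in HJ. destruct HJ as [Jc Jd].
  assert (rational (sn P)) by (rewrite EP; pose proof (int_at_rational l t Ht); prove_rational).
  assert (rational (cn P)) by eauto using int_at_rational, one_mod_sq_int_at.
  assert (rational (dn P)) by eauto using int_at_rational, one_mod_sq_int_at.
  assert (rational x) by (rewrite Eu; prove_rational).
  assert (rational w1) by eauto using int_at_rational.
  assert (Hs : 0 < x * w1 * Rabs (sn P) < eps).
  { split; [apply Rmult_lt_0_compat; lra |].
    replace eps with (x * w1 * (eps / (x * w1))) by (field; lra).
    apply Rmult_lt_compat_l; lra. }
  (* The equations are even in [sn], so its sign may be dropped. *)
  exists (x * w1 * Rabs (sn P)), (cn P), (dn P).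
  assert (E2 : (x * w1 * Rabs (sn P)) ^ 2 = (x * w1) ^ 2 * sn P ^ 2)
    by (rewrite Rpow_mult_distr, <- (pow2_abs (sn P)); reflexivity).
  repeat split; auto; try lra.
  - unfold Rabs. destruct (Rcase_abs (sn P)); prove_rational.
  - rewrite Jc, E2. ring.
  - rewrite Jd, E2. ring.
Qed.

(** * Triangles *)

Lemma arcosh_ln (y : R) : 1 <= y -> arcosh ((y + / y) / 2) = ln y.
Proof.
  intros Hy. unfold arcosh. f_equal.
  assert (Hi : / y <= 1) by (rewrite <- Rinv_1; apply Rinv_le_contravar; lra).
  replace (((y + / y) / 2) ^ 2 - 1) with (((y - / y) / 2) ^ 2) by (field; lra).
  rewrite sqrt_pow2 by lra. field. lra.
Qed.

Lemma cosh_ln_lt (x y : R) : 1 <= x -> x < y -> x + / x < y + / y.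
Proof.
  intros Hx Hxy. apply Rlt_0_minus.
  replace (y + / y - (x + / x)) with ((y - x) * (1 - / (x * y))) by (field; lra).
  apply Rmult_lt_0_compat; [lra |].
  assert (/ (x * y) < 1); [| lra]. rewrite <- Rinv_1. apply Rinv_lt_contravar; nra.
Qed.

(* [B] and [C] are symmetric about the origin (1,0,0), which is the midpoint of [BC]. *)
Lemma good_third_side_of_curve (u w v x : R) :
  1 < u -> 1 < w -> 1 < x -> v < w * u ^ 2 -> w / u ^ 2 < v -> u ^ 2 / w < v ->
  rational u -> rational w -> rational v -> rational x ->
  v + / v + (w + / w) = (u + / u) * (x + / x) ->
  good_third_side u w (ln v).
Proof.
  intros Hu Hw Hx H1 H2 H3 Ru Rw Rv Rx E.
  assert (Hu2 : 1 < u ^ 2) by nra.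
  (* The two lower bounds for [v] are inverse to each other. *)
  assert (Hv : 1 < v).
  { assert (0 < w / u ^ 2) by (apply Rdiv_lt_0_compat; lra).
    assert (0 < u ^ 2 / w) by (apply Rdiv_lt_0_compat; lra).
    assert (w / u ^ 2 * (u ^ 2 / w) = 1) by (field; lra). nra. }
  set (V := v + / v) in *. set (W := w + / w) in *. set (U := u + / u) in *.
  (* With a = 2 log u and b = log w, these are 2 sinh (a/2), 2 cosh (a + b) and, next, 2 cosh (a -
     b). *)
  set (S := u - / u). set (V1 := w * u ^ 2 + / (w * u ^ 2)).
  set (V2 := w / u ^ 2 + u ^ 2 / w).
  assert (HV1 : V < V1) by (apply cosh_ln_lt; lra).
  assert (HV2 : V2 < V).
  { destruct (Rle_dec w (u ^ 2)) as [Hwu | Hwu].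
    - replace V2 with (u ^ 2 / w + / (u ^ 2 / w)) by (unfold V2; field; lra).
      apply cosh_ln_lt; [| assumption].
      apply (Rmult_le_reg_r w); [lra |]. unfold Rdiv. rewrite Rmult_assoc, Rinv_l; lra.
    - replace V2 with (w / u ^ 2 + / (w / u ^ 2)) by (unfold V2; field; lra).
      apply cosh_ln_lt; [| assumption].
      apply (Rmult_le_reg_r (u ^ 2)); [lra |]. unfold Rdiv. rewrite Rmult_assoc, Rinv_l; lra. }
  assert (Hiu : 0 < / u < 1).
  { split; [apply Rinv_0_lt_compat; lra |]. rewrite <- Rinv_1. apply Rinv_lt_contravar; lra. }
  assert (HU : 0 < U) by (unfold U; lra). assert (HS : 0 < S) by (unfold S; lra).
  (* The apex is [(p, q, r)]: [p] is the cosh of its distance to the midpoint (1, 0, 0), and [q] is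
     forced by the difference of the equations for the other two sides. *)
  pose (p := (x + / x) / 2). pose (q := (W - V) / (2 * S)).
  assert (Ep : p = (V + W) / (2 * U)) by (unfold p; rewrite E; field; lra).
  (* The squared height factors, up to a positive constant, as [(V1 - V) * (V - V2)]: its positivity
     is the triangle inequality. *)
  assert (Hheight : 0 < p ^ 2 - 1 - q ^ 2).
  { assert (EUS : U ^ 2 * S ^ 2 * (p ^ 2 - 1 - q ^ 2) = (V1 - V) * (V - V2)).
    { transitivity ((S ^ 2 * (V + W) ^ 2 - 4 * U ^ 2 * S ^ 2 - U ^ 2 * (W - V) ^ 2) / 4);
        [unfold q; rewrite Ep; field; lra |].
      unfold S, U, W, V1, V2. clearbody V. field. lra. }
    apply (Rmult_lt_reg_l (U ^ 2 * S ^ 2)); [apply Rmult_lt_0_compat; apply pow_lt; lra |].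
    rewrite Rmult_0_r, EUS. apply Rmult_lt_0_compat; lra. }
  pose (r := sqrt (p ^ 2 - 1 - q ^ 2)).
  assert (Hr : 0 < r) by now apply sqrt_lt_R0.
  assert (Er : r ^ 2 = p ^ 2 - 1 - q ^ 2) by (apply pow2_sqrt; lra).
  assert (Hp : 0 < p).
  { unfold p. pose proof (Rinv_0_lt_compat x ltac:(lra)). lra. }
  assert (EBC : hdist (U / 2, S / 2, 0) (U / 2, - (S / 2), 0) = 2 * ln u).
  { unfold hdist, mink, c0, Defs.c1, c2; cbn [fst snd].
    replace (U / 2 * (U / 2) - S / 2 * - (S / 2) - 0 * 0) with ((u ^ 2 + / u ^ 2) / 2)
      by (unfold U, S; field; lra).
    rewrite arcosh_ln by lra. rewrite ln_pow by lra. simpl INR. lra. }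
  assert (ECA : hdist (U / 2, - (S / 2), 0) (p, q, r) = ln w).
  { unfold hdist, mink, c0, Defs.c1, c2; cbn [fst snd].
    replace (U / 2 * p - - (S / 2) * q - 0 * r) with (W / 2)
      by (rewrite Ep; unfold q; field; lra).
    unfold W. rewrite arcosh_ln by lra. reflexivity. }
  assert (EAB : hdist (p, q, r) (U / 2, S / 2, 0) = ln v).
  { unfold hdist, mink, c0, Defs.c1, c2; cbn [fst snd].
    replace (p * (U / 2) - q * (S / 2) - r * 0) with (V / 2)
      by (rewrite Ep; unfold q; field; lra).
    unfold V. rewrite arcosh_ln by lra. reflexivity. }
  exists (p, q, r), (U / 2, S / 2, 0), (U / 2, - (S / 2), 0).
  rewrite EBC, ECA, EAB.
  unfold on_H, nondegenerate, det3, rational_length, is_midpoint.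
  unfold c0, Defs.c1, c2; cbn [fst snd].
  assert (Ech : (U / 2) ^ 2 - (S / 2) ^ 2 = 1) by (unfold U, S; field; lra).
  split; [split; [assumption | lra] |].
  split; [split; lra |]. split; [split; [lra |]; rewrite <- Ech; ring |].
  split.
  { replace (p * (S / 2 * 0 - 0 * - (S / 2)) - q * (U / 2 * 0 - 0 * (U / 2))
             + r * (U / 2 * - (S / 2) - S / 2 * (U / 2))) with (- (r * U * S / 2)) by field.
    assert (0 < r * U * S) by (repeat apply Rmult_lt_0_compat; assumption). lra. }
  do 3 (split; [reflexivity |]).
  split; [| split; [| split]].
  - destruct (rational_pow u 2 Ru) as [z Hz]. exists z. rewrite <- Hz.
    replace (2 * ln u) with (ln (u ^ 2)) by (rewrite ln_pow by lra; simpl INR; lra).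
    apply exp_ln. lra.
  - destruct Rw as [z Hz]. exists z. rewrite <- Hz. apply exp_ln. lra.
  - destruct Rv as [z Hz]. exists z. rewrite <- Hz. apply exp_ln. lra.
  - exists (1, 0, 0). rewrite EBC. unfold on_H, hdist, mink, c0, Defs.c1, c2; cbn [fst snd].
    split; [split; [split; [lra | ring] | split] |].
    + replace (U / 2 * 1 - S / 2 * 0 - 0 * 0) with (U / 2) by ring.
      unfold U. rewrite arcosh_ln by lra. lra.
    + replace (1 * (U / 2) - 0 * - (S / 2) - 0 * 0) with (U / 2) by ring.
      unfold U. rewrite arcosh_ln by lra. lra.
    + replace (p * 1 - q * 0 - r * 0) with p by ring.
      unfold p. rewrite arcosh_ln by lra.
      destruct Rx as [z Hz]. exists z. rewrite <- Hz. apply exp_ln. lra.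
Qed.

(** * Translating the degenerate triangle *)

(* The action of the curve [jacobi (k0 * k3) (k1 * k2)] on k0 + k1 p^2 + k2 q^2 + k3 p^2 q^2 = 0,
   by the addition formulas of Jacobi's elliptic functions. *)
Lemma translated_point_on_curve (k0 k1 k2 k3 p q s c d : R) :
  k0 + k1 * p ^ 2 + k2 * q ^ 2 + k3 * p ^ 2 * q ^ 2 = 0 ->
  c ^ 2 = 1 - k0 * k3 * s ^ 2 -> d ^ 2 = 1 - k1 * k2 * s ^ 2 ->
  1 + k1 * k3 * p ^ 2 * s ^ 2 <> 0 -> 1 + k2 * k3 * q ^ 2 * s ^ 2 <> 0 ->
  let p' := (p * (c * d) + s * q * (k2 + k3 * p ^ 2)) / (1 + k1 * k3 * p ^ 2 * s ^ 2) in
  let q' := (q * (c * d) - s * p * (k1 + k3 * q ^ 2)) / (1 + k2 * k3 * q ^ 2 * s ^ 2) in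
  k0 + k1 * p' ^ 2 + k2 * q' ^ 2 + k3 * p' ^ 2 * q' ^ 2 = 0.
Proof.
  intros E Hc Hd HA HB p' q'.
  assert (E0 : k0 = - (k1 * p ^ 2 + k2 * q ^ 2 + k3 * p ^ 2 * q ^ 2)) by lra.
  set (A := 1 + k1 * k3 * p ^ 2 * s ^ 2) in *. set (B := 1 + k2 * k3 * q ^ 2 * s ^ 2) in *.
  set (x := p * (c * d) + s * q * (k2 + k3 * p ^ 2)) in *.
  set (y := q * (c * d) - s * p * (k1 + k3 * q ^ 2)) in *.
  transitivity ((k0 * A ^ 2 * B ^ 2 + k1 * x ^ 2 * B ^ 2 + k2 * y ^ 2 * A ^ 2 + k3 * x ^ 2 * y ^ 2)
    / (A ^ 2 * B ^ 2)); [unfold p', q'; field; now split |].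
  replace (k0 * A ^ 2 * B ^ 2 + k1 * x ^ 2 * B ^ 2 + k2 * y ^ 2 * A ^ 2 + k3 * x ^ 2 * y ^ 2)
    with 0; [unfold Rdiv; ring |].
  clear E p' q'. subst k0. unfold A, B, x, y. ring [Hc Hd].
Qed.

(** A small translation with [s > 0] moves [p] downwards to first order, so [v] drops below the
    degenerate value [w * u ^ 2]; the remaining strict inequalities persist by continuity. *)
Lemma good_third_side_near_degenerate (u w : Q) (dl : R) :
  1 < Q2R u -> 1 < Q2R w -> 0 < dl ->
  let U := Q2R u + / Q2R u in
  let W := Q2R w + / Q2R w in
  W ^ 2 - 4 * (U - 1) ^ 2 <> 0 ->
  exists v, Q2R w * Q2R u ^ 2 - dl < v < Q2R w * Q2R u ^ 2 /\
    good_third_side (Q2R u) (Q2R w) (ln v).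
Proof.
  intros Hu Hw Hdl U W Ha.
  pose proof (fun eps He => rational_jacobi_small u w eps Hu Hw He Ha) as small.
  cbv zeta in small. fold U W in small.
  assert (Ru : rational (Q2R u)) by now exists u. assert (Rw : rational (Q2R w)) by now exists w.
  set (x := Q2R u) in *. set (y := Q2R w) in *. clearbody x y.
  set (a := W ^ 2 - 4 * (U - 1) ^ 2) in *. set (b := W ^ 2 - 4 * (U + 1) ^ 2) in *.
  (* The coefficients of [v + / v + W = U * (t + / t)] after setting [v = (1 + p) / (1 - p)] and
     [t = (1 + q) / (1 - q)] and clearing denominators. *)
  pose (k0 := 2 + W - 2 * U). pose (k1 := 2 - W + 2 * U).
  pose (k2 := - (2 + W + 2 * U)). pose (k3 := W - 2 + 2 * U).
  assert (Hix : 0 < / x < 1).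
  { split; [apply Rinv_0_lt_compat; lra |]. rewrite <- Rinv_1. apply Rinv_lt_contravar; lra. }
  assert (Hiy : 0 < / y < 1).
  { split; [apply Rinv_0_lt_compat; lra |]. rewrite <- Rinv_1. apply Rinv_lt_contravar; lra. }
  assert (HU : 1 < U) by (unfold U; lra). assert (HW : 1 < W) by (unfold W; lra).
  assert (Hx2 : 1 < x ^ 2) by nra. assert (Hyx2 : 1 < y * x ^ 2) by nra.
  assert (Hyx : 1 < y * x) by nra.
  pose (p := (y * x ^ 2 - 1) / (y * x ^ 2 + 1)). pose (q := (y * x - 1) / (y * x + 1)).
  assert (Hp : 0 < p < 1).
  { unfold p. split; [apply Rdiv_lt_0_compat; lra |].
    apply (Rmult_lt_reg_r (y * x ^ 2 + 1)); [lra |].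
    unfold Rdiv. rewrite Rmult_assoc, Rinv_l; lra. }
  assert (Hq : 0 < q < 1).
  { unfold q. split; [apply Rdiv_lt_0_compat; lra |].
    apply (Rmult_lt_reg_r (y * x + 1)); [lra |].
    unfold Rdiv. rewrite Rmult_assoc, Rinv_l; lra. }
  assert (Ep : (1 + p) / (1 - p) = y * x ^ 2) by (unfold p; field; lra).
  assert (Eq : (1 + q) / (1 - q) = y * x) by (unfold q; field; lra).
  assert (Epq : k0 + k1 * p ^ 2 + k2 * q ^ 2 + k3 * p ^ 2 * q ^ 2 = 0)
    by (unfold p, q, k0, k1, k2, k3, U, W; field; lra).
  assert (Ea : a = k0 * k3) by (unfold a, k0, k3; ring).
  assert (Eb : b = k1 * k2) by (unfold b, k1, k2; ring).
  assert (Rp : rational p) by (unfold p; prove_rational).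
  assert (Rq : rational q) by (unfold q; prove_rational).
  clearbody p q.
  (* This is the derivative of [f] at 0; it is negative because [k2 + k3 = -4], [k3 > 0] and
     [p ^ 2 < 1]. *)
  assert (Hslope : q * (k2 + k3 * p ^ 2) < 0).
  { assert (k2 + k3 * p ^ 2 < 0); [| nra].
    assert (0 < p ^ 2 < 1) by nra. unfold k2, k3. nra. }
  assert (RU : rational U) by (unfold U; prove_rational).
  assert (RW : rational W) by (unfold W; prove_rational).
  assert (Rk1 : rational k1) by (unfold k1; prove_rational).
  assert (Rk2 : rational k2) by (unfold k2; prove_rational).
  assert (Rk3 : rational k3) by (unfold k3; prove_rational).
  assert (Ek1 : k1 = 2 - W + 2 * U) by reflexivity.
  assert (Ek2 : k2 = - (2 + W + 2 * U)) by reflexivity.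
  assert (Ek3 : k3 = W - 2 + 2 * U) by reflexivity.
  clearbody k1 k2 k3.
  pose (A := fun s => 1 + k1 * k3 * p ^ 2 * s ^ 2).
  pose (B := fun s => 1 + k2 * k3 * q ^ 2 * s ^ 2).
  pose (G := fun s => sqrt ((1 - a * s ^ 2) * (1 - b * s ^ 2))).
  pose (f := fun s => (p * G s + s * q * (k2 + k3 * p ^ 2)) / A s).
  pose (g := fun s => (q * G s - s * p * (k1 + k3 * q ^ 2)) / B s).
  assert (G0 : G 0 = 1) by (unfold G; rewrite pow_ne_zero by lia;
    replace ((1 - a * 0) * (1 - b * 0)) with 1 by ring; apply sqrt_1).
  assert (A0 : A 0 = 1) by (unfold A; simpl; ring).
  assert (B0 : B 0 = 1) by (unfold B; simpl; ring).
  assert (f0 : f 0 = p) by (unfold f; rewrite G0, A0; field).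
  assert (g0 : g 0 = q) by (unfold g; rewrite G0, B0; field).
  assert (cA : continuity_pt A 0) by (unfold A; reg).
  assert (cB : continuity_pt B 0) by (unfold B; reg).
  assert (cG : continuity_pt G 0) by (unfold G; reg; simpl; lra).
  assert (cf : continuity_pt f 0) by (unfold f; reg; auto; lra).
  assert (cg : continuity_pt g 0) by (unfold g; reg; auto; lra).
  pose (v := fun s => (1 + f s) / (1 - f s)). pose (t := fun s => (1 + g s) / (1 - g s)).
  assert (v0 : v 0 = y * x ^ 2) by (unfold v; rewrite f0; exact Ep).
  assert (t0 : t 0 = y * x) by (unfold t; rewrite g0; exact Eq).
  assert (cv : continuity_pt v 0) by (unfold v; reg; rewrite f0; lra).
  assert (ct : continuity_pt t 0) by (unfold t; reg; rewrite g0; lra).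
  (* From [c * d <= (1 + (c * d) ^ 2) / 2] the numerator of [f s] is at most
     [p * A s + s * slope s], so [f s < p] follows without differentiating the square root. *)
  pose (slope := fun s => q * (k2 + k3 * p ^ 2)
                          + s * (p * (a * b * s ^ 2 - a - b) / 2 - p ^ 3 * k1 * k3)).
  (* Collects the required closeness and the two other triangle inequalities. *)
  pose (L := Rmax (y * x ^ 2 - dl) (Rmax (y / x ^ 2) (x ^ 2 / y))).
  assert (HL : L < y * x ^ 2).
  { unfold L. repeat apply Rmax_lub_lt; [lra | |].
    - apply (Rmult_lt_reg_r (x ^ 2)); [lra |].
      unfold Rdiv. rewrite Rmult_assoc, Rinv_l by lra. nra.
    - apply (Rmult_lt_reg_r y); [lra |].
      unfold Rdiv. rewrite Rmult_assoc, Rinv_l by lra. nra. }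
  destruct (continuity_pt_lt (fun s => - v s) 0 (- L)) as (d1 & Hd1 & C1);
    [reg | rewrite v0; lra |].
  destruct (continuity_pt_lt (fun s => - t s) 0 (- 1)) as (d2 & Hd2 & C2);
    [reg | rewrite t0; lra |].
  destruct (continuity_pt_lt g 0 1) as (d3 & Hd3 & C3); [assumption | rewrite g0; lra |].
  destruct (continuity_pt_lt (fun s => - A s) 0 0) as (d4 & Hd4 & C4); [reg | rewrite A0; lra |].
  destruct (continuity_pt_lt (fun s => - B s) 0 0) as (d5 & Hd5 & C5); [reg | rewrite B0; lra |].
  destruct (continuity_pt_lt slope 0 0) as (d6 & Hd6 & C6);
    [unfold slope; reg | unfold slope; rewrite Rmult_0_l; lra |].
  destruct (small (Rmin (Rmin (Rmin d1 d2) (Rmin d3 d4)) (Rmin d5 d6)))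
    as (s & c & d & Rs & Rc & Rd & Hs & Hc & Hd & Ec & Ed).
  { repeat apply Rmin_glb_lt; assumption. }
  pose proof (Rmin_l (Rmin (Rmin d1 d2) (Rmin d3 d4)) (Rmin d5 d6)).
  pose proof (Rmin_r (Rmin (Rmin d1 d2) (Rmin d3 d4)) (Rmin d5 d6)).
  pose proof (Rmin_l (Rmin d1 d2) (Rmin d3 d4)). pose proof (Rmin_r (Rmin d1 d2) (Rmin d3 d4)).
  pose proof (Rmin_l d1 d2). pose proof (Rmin_r d1 d2). pose proof (Rmin_l d3 d4).
  pose proof (Rmin_r d3 d4). pose proof (Rmin_l d5 d6). pose proof (Rmin_r d5 d6).
  assert (Hs' : Rabs (s - 0) = s) by (rewrite Rminus_0_r; apply Rabs_right; lra).
  specialize (C1 s); specialize (C2 s); specialize (C3 s);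
    specialize (C4 s); specialize (C5 s); specialize (C6 s).
  rewrite Hs' in C1, C2, C3, C4, C5, C6.
  specialize (C1 ltac:(lra)); specialize (C2 ltac:(lra)); specialize (C3 ltac:(lra)).
  specialize (C4 ltac:(lra)); specialize (C5 ltac:(lra)); specialize (C6 ltac:(lra)).
  assert (HL1 : y * x ^ 2 - dl <= L) by apply Rmax_l.
  assert (HL2 : y / x ^ 2 <= L) by (eapply Rle_trans; [apply Rmax_l | apply Rmax_r]).
  assert (HL3 : x ^ 2 / y <= L) by (eapply Rle_trans; [apply Rmax_r | apply Rmax_r]).
  assert (Ecd : (c * d) ^ 2 = (1 - a * s ^ 2) * (1 - b * s ^ 2))
    by (rewrite Rpow_mult_distr, Ec, Ed; reflexivity).
  (* Positivity of [c] and [d] identifies the square root, which makes [f s] and [g s] rational. *)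
  assert (EG : G s = c * d) by (unfold G; rewrite <- Ecd; apply sqrt_pow2; nra).
  assert (Rf : rational (f s))
    by (unfold f, Rdiv; rewrite EG; unfold A; prove_rational).
  assert (Rg : rational (g s))
    by (unfold g, Rdiv; rewrite EG; unfold B; prove_rational).
  assert (Hfp : f s < p).
  { apply (Rmult_lt_reg_r (A s)); [lra |].
    unfold f. rewrite EG. unfold Rdiv. rewrite Rmult_assoc, Rinv_l, Rmult_1_r by lra.
    assert (Hsq : p * (c * d) <= p * (1 + (c * d) ^ 2) / 2)
      by (pose proof (pow2_ge_0 (c * d - 1)); nra).
    assert (Hsl : s * slope s < 0) by nra.
    assert (Es : p * (1 + (c * d) ^ 2) / 2 + s * q * (k2 + k3 * p ^ 2) = p * A s + s * slope s)
      by (rewrite Ecd; unfold A, slope; field).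
    lra. }
  assert (Hv : v s < y * x ^ 2).
  { rewrite <- Ep. unfold v.
    replace ((1 + f s) / (1 - f s)) with (2 * / (1 - f s) - 1) by (field; lra).
    replace ((1 + p) / (1 - p)) with (2 * / (1 - p) - 1) by (field; lra).
    assert (/ (1 - f s) < / (1 - p)); [| lra]. apply Rinv_lt_contravar; nra. }
  exists (v s). split; [lra |].
  apply (good_third_side_of_curve x y (v s) (t s)); try lra; auto;
    try (unfold v, t; prove_rational).
  assert (Hv0 : 0 < v s).
  { assert (0 < x ^ 2 / y) by (apply Rdiv_lt_0_compat; lra). lra. }
  assert (Hf1 : 1 + f s <> 0).
  { intros E. unfold v in Hv0. rewrite E in Hv0. unfold Rdiv in Hv0. lra. }
  assert (Hg1 : 1 + g s <> 0).
  { intros E. unfold t in C2. rewrite E in C2. unfold Rdiv in C2. lra. }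
  pose proof (translated_point_on_curve k0 k1 k2 k3 p q s c d Epq) as Ecurve.
  cbv zeta in Ecurve. rewrite <- EG in Ecurve.
  fold (A s) (B s) in Ecurve. fold (f s) (g s) in Ecurve.
  specialize (Ecurve ltac:(rewrite <- Ea; exact Ec) ltac:(rewrite <- Eb; exact Ed)
    ltac:(lra) ltac:(lra)).
  assert (Hfg : v s + / v s + W - U * (t s + / t s)
    = (k0 + k1 * f s ^ 2 + k2 * g s ^ 2 + k3 * f s ^ 2 * g s ^ 2)
      / ((1 - f s ^ 2) * (1 - g s ^ 2))).
  { unfold v, t. rewrite Ek1, Ek2, Ek3. unfold k0. field. repeat split; try lra; nra. }
  rewrite Ecurve in Hfg. unfold Rdiv in Hfg. rewrite Rmult_0_l in Hfg.
  apply Rminus_diag_uniq. exact Hfg.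
Qed.

(** Entries with [exp r < x] are avoided by shrinking [dl]; the others cannot equal [ln y] for
    [y < x]. Third sides accumulating at the degenerate one therefore escape every finite list. *)
Lemma ln_notin_left_neighbourhood (x : R) (l : list R) : 0 < x ->
  exists dl, 0 < dl /\ forall y, 0 < y -> x - dl < y < x -> ~ In (ln y) l.
Proof.
  intros Hx. induction l as [| r l (dl & Hdl & IH)].
  - exists 1. split; [lra | auto].
  - destruct (Rlt_or_le (exp r) x) as [Hr | Hr].
    + exists (Rmin dl (x - exp r)). split; [apply Rmin_glb_lt; lra |].
      pose proof (Rmin_l dl (x - exp r)). pose proof (Rmin_r dl (x - exp r)).
      intros y Hy Hxy [E | Hin]; [| revert Hin; apply IH; lra].
      rewrite E, exp_ln in *; lra.
    + exists dl. split; [assumption |].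
      intros y Hy Hxy [E | Hin]; [| revert Hin; now apply IH].
      rewrite E, exp_ln in Hr; lra.
Qed.

Theorem mainTheorem12 :
  exists (n : nat) (c : nat -> nat -> Z),
    poly2_nonzero n c /\
    forall u w : Q,
      1 < Q2R u -> 1 < Q2R w ->
      poly2_eval n c (Q2R u) (Q2R w) <> 0 ->
      forall l : list R,
        exists s : R, good_third_side (Q2R u) (Q2R w) s /\ ~ In s l.
Proof.
  (* The excluded curve W = 2 (U - 1) with U = u + 1/u and W = w + 1/w, cleared of denominators:
     there the curve acting by translations is singular. *)
  exists 2%nat, (fun i j => match i, j with
    | 1%nat, 2%nat => 1 | 1%nat, 0%nat => 1 | 2%nat, 1%nat => -2 | 0%nat, 1%nat => -2
    | 1%nat, 1%nat => 2 | _, _ => 0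
    end)%Z.
  split; [exists 1%nat, 2%nat; repeat split; auto; discriminate |].
  intros u w Hu Hw Hpoly l.
  set (x := Q2R u) in *. set (y := Q2R w) in *.
  assert (Ha : (y + / y) ^ 2 - 4 * (x + / x - 1) ^ 2 <> 0).
  { intros E. apply Hpoly. unfold poly2_eval; simpl.
    assert (Hix : 0 < / x) by (apply Rinv_0_lt_compat; lra).
    assert (Hiy : 0 < / y) by (apply Rinv_0_lt_compat; lra).
    assert (E' : (y + / y - 2 * (x + / x - 1)) * (y + / y + 2 * (x + / x - 1)) = 0)
      by (rewrite <- E; ring).
    (* The second factor is positive for [x > 1]; the first, times [x * y], is the chosen
       polynomial. *)
    apply Rmult_integral in E' as [E' | E']; [| lra].
    transitivity (x * y * (y + / y - 2 * (x + / x - 1))); [field; lra | rewrite E'; ring]. }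
  assert (Hx2 : 1 < x ^ 2) by nra.
  destruct (ln_notin_left_neighbourhood (y * x ^ 2) l) as (dl & Hdl & Hl); [nra |].
  (* The minimum with [y * x ^ 2] ensures [v > 0]. *)
  destruct (good_third_side_near_degenerate u w (Rmin dl (y * x ^ 2)) Hu Hw) as (v & Hv & Hgood).
  { apply Rmin_glb_lt; nra. }
  { exact Ha. }
  fold x y in Hv.
  pose proof (Rmin_l dl (y * x ^ 2)). pose proof (Rmin_r dl (y * x ^ 2)).
  exists (ln v). split; [assumption |]. apply Hl; lra.
Qed.
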